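(* There is a constant $C$ such that for every $N$ and every two binary strings $a,b$ of length at most $N$ there exists a program $f$ which on input $a$ outputs $b$ and satisfies $$\bigl|\mathrm{KS}(b\mid f)-\min\{\mathrm{KS}(a),\mathrm{KS}(b)\}\bigr|\le C\log N.$$ (Equivalently, one may take $f$ to be a total function from the set of binary strings of length at most $N$ to itself with $f(a)=b$, encoded as a finite object.)
   Context: $\mathrm{KS}(u)$ and $\mathrm{KS}(u\mid v)$ denote plain and conditional Kolmogorov complexity of binary strings with respect to a fixed optimal programming language; programs and finite functions are regarded as binary strings via a fixed encoding. All $O(\log N)$ terms are up to a constant not depending on the strings or $N$. *)

(* Defs.v *)
From mathcomp Require Import all_boot.
From Stdlib Require Import ClassicalEpsilon.
Set Implicit Arguments. Unset Strict Implicit. Unset Printing Implicit Defensive.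

(* bijective base 2: [::] -> 0, [0] -> 1, [1] -> 2, [0;0] -> 3, ... *)
Definition nat_of_bits (s : seq bool) : nat :=
  foldl (fun n (b : bool) => n.*2 + 1 + b) 0 s.

Fixpoint bits_of_nat_aux (fuel n : nat) : seq bool :=
  match fuel with
  | 0 => [::]
  | f.+1 => if n is 0 then [::]
            else rcons (bits_of_nat_aux f (n.-1 %/ 2)) (odd n.-1)
  end.
Definition bits_of_nat (n : nat) : seq bool := bits_of_nat_aux n n.

Inductive instr := INC of nat | DECJZ of nat & nat.

Fixpoint exec (fuel : nat) (prog : seq instr) (regs : nat -> nat) (pc : nat)
  : option (nat -> nat) :=
  match fuel with
  | 0 => None
  | f.+1 =>
    if pc < size prog then
      match nth (INC 0) prog pc with
      | INC r => exec f prog (fun i => if i == r then (regs i).+1 else regs i) pc.+1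
      | DECJZ r j =>
          if regs r == 0 then exec f prog regs j
          else exec f prog (fun i => if i == r then (regs i).-1 else regs i) pc.+1
      end
    else Some regs
  end.

Fixpoint parse_unary (s : seq bool) : option (nat * seq bool) :=
  match s with
  | [::] => None
  | false :: t => Some (0, t)
  | true :: t => if parse_unary t is Some (k, t') then Some (k.+1, t') else None
  end.

(* program code: each instruction is 1 0 <r> (INC r) or 1 1 <r> <j> (DECJZ r j),
   numbers in unary (1^k 0); the code is terminated by a single 0. *)
Fixpoint parse_prog (fuel : nat) (s : seq bool) : option (seq instr * seq bool) :=
  match fuel with
  | 0 => None
  | f.+1 =>
    match s with
    | false :: t => Some ([::], t)
    | true :: false :: t =>
        match parse_unary t with
        | Some (r, t1) =>
            match parse_prog f t1 with
            | Some (p, rest) => Some (INC r :: p, rest)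
            | None => None end
        | None => None end
    | true :: true :: t =>
        match parse_unary t with
        | Some (r, t1) =>
            match parse_unary t1 with
            | Some (j, t2) =>
                match parse_prog f t2 with
                | Some (p, rest) => Some (DECJZ r j :: p, rest)
                | None => None end
            | None => None end
        | None => None end
    | _ => None
    end
  end.

Definition init_regs (r v : seq bool) : nat -> nat :=
  fun i => if i == 0 then nat_of_bits r else if i == 1 then nat_of_bits v else 0.

Definition run_U (fuel : nat) (p v : seq bool) : option (seq bool) :=
  match p with
  | [::] => None
  | false :: s => Some s
  | true :: q =>
      match parse_prog (size q).+1 q with
      | Some (prog, r) =>
          omap (fun regs => bits_of_nat (regs 0)) (exec fuel prog (init_regs r v) 0)
      | None => None
      end
  end.

Definition outputs (p v u : seq bool) : Prop := exists n, run_U n p v = Some u.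

Definition decP (P : Prop) : bool :=
  if excluded_middle_informative P then true else false.

Definition has_prog_of_size (u v : seq bool) (k : nat) : bool :=
  decP (exists p, size p = k /\ outputs p v u).

Lemma has_prog_ex (u v : seq bool) : exists k, has_prog_of_size u v k.
Proof.
exists (size u).+1; rewrite /has_prog_of_size /decP.
case: excluded_middle_informative => // [[]].
by exists (false :: u); split => //; exists 0.
Qed.

Definition KScond (u v : seq bool) : nat := ex_minn (has_prog_ex u v).
(* plain complexity KS(u) := KS(u | empty string) (equal up to O(1)) *)
Definition KS (u : seq bool) : nat := KScond u [::].

Definition logN (N : nat) : nat := (trunc_log 2 N).+1.

(* Main.v *)
Require Import Defs.
From mathcomp Require Import all_boot.
From mathcomp Require Import zify.
From Stdlib Require Import FunctionalExtensionality ClassicalEpsilon.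
Set Implicit Arguments. Unset Strict Implicit. Unset Printing Implicit Defensive.

(* Let [M = 2 ^ 2 ^ l] with [l] about [log N], and let [f] range over the tables of functions
   from [0 .. M-1] to itself.  For [k = min (KS a) (KS b) - O(log N)], call a pair [(x, y)] bad
   if every table [f] with [f x = y] satisfies [KScond y f < k].  A matching of bad pairs
   extends to a single table [f], and all its right ends have complexity below [k] given [f];
   so it has at most [2 ^ k] edges.  Bad pairs can be enumerated, and greedily so can a maximal
   matching, whose ends cover all bad pairs.  If [(a, b)] were bad, then [a] or [b] would be
   an end of an edge, hence determined by [l], [k] and the rank of that edge, and so of
   complexity at most [k + O(log N)], which is too small.  So some table with [f a = b] has
   [KScond b f >= k]; the upper bound holds for every table, as [b = f a].

   Enumerating the bad pairs requires an interpreter of counter machine programs that is itself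
   a counter machine program.  It is obtained from a class of functions that contains the
   primitive recursive ones and whose members are computed by counter machines. *)

(** * While programs and counter machines *)

(* [Loop r c] is [while r <> 0 { r--; c }], as permitted by [DECJZ].  The jump back tests
   register 2, which therefore has to be 0 at the end of the body. *)
Inductive cmd := Skip | Inc of nat | Seq of cmd & cmd | Loop of nat & cmd.

Definition upd (g : nat -> nat) r v := fun i => if i == r then v else g i.

Lemma upd_same g r v : upd g r v r = v.
Proof. by rewrite /upd eqxx. Qed.

Lemma upd_other g r v i : i != r -> upd g r v i = g i.
Proof. by rewrite /upd => /negbTE ->. Qed.

Lemma upd_map (F : nat -> nat) g r :
  (fun i => if i == r then F (g i) else g i) = upd g r (F (g r)).
Proof. by apply: functional_extensionality => i; rewrite /upd; case: eqP => // ->. Qed.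

Inductive runs : cmd -> (nat -> nat) -> (nat -> nat) -> Prop :=
| RunsSkip g : runs Skip g g
| RunsInc r g : runs (Inc r) g (upd g r (g r).+1)
| RunsSeq c1 c2 g1 g2 g3 : runs c1 g1 g2 -> runs c2 g2 g3 -> runs (Seq c1 c2) g1 g3
| RunsLoop0 r c g : g r = 0 -> runs (Loop r c) g g
| RunsLoopS r c g g1 g2 : g r != 0 -> runs c (upd g r (g r).-1) g1 -> g1 2 = 0 ->
    runs (Loop r c) g1 g2 -> runs (Loop r c) g g2.

Fixpoint code c pc : seq instr :=
  match c with
  | Skip => [::]
  | Inc r => [:: INC r]
  | Seq c1 c2 => code c1 pc ++ code c2 (pc + size (code c1 pc))
  | Loop r c => DECJZ r (pc + size (code c pc.+1) + 2) ::
                code c pc.+1 ++ [:: DECJZ 2 pc]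
  end.

(** Jump targets are absolute, so the code is placed behind an arbitrary prefix; the fuel left over
    is arbitrary, so that runs can be chained. The induction is on the run. *)
Lemma code_exec c g g' : runs c g g' -> forall pre post,
  let prog := pre ++ code c (size pre) ++ post in
  exists n, forall fuel, exec (n + fuel) prog g (size pre) =
    exec fuel prog g' (size pre + size (code c (size pre))).
Proof.
elim=> {c g g'} [g|r g|c1 c2 g1 g2 g3 _ IH1 _ IH2|r c g g0|r c g g1 g2 gn0 _ IHc g10 _ IHl]
  pre post prog.
- by exists 0 => fuel; rewrite addn0.
- exists 1 => fuel; rewrite add1n [LHS]/= {1}/prog size_cat /= addnS ltnS leq_addr.
  by rewrite {1}/prog nth_cat ltnn subnn /= addn1 (upd_map S).
- set k := size (code c1 (size pre)).
  have [n1 H1] := IH1 pre (code c2 (size pre + k) ++ post).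
  have [n2 H2] := IH2 (pre ++ code c1 (size pre)) post.
  rewrite size_cat -/k -!catA in H2.
  exists (n1 + n2) => fuel; rewrite -addnA /prog /= -!catA H1 -/k H2.
  by rewrite size_cat -/k addnA.
- exists 1 => fuel; rewrite add1n [LHS]/= {1}/prog size_cat /= addnS ltnS leq_addr.
  rewrite {1}/prog nth_cat ltnn subnn /= g0 eqxx size_cat /=.
  by congr (exec _ _ _ _); lia.
- set k := size (code c (size pre).+1).
  set d := DECJZ r (size pre + k + 2).
  have [n1 H1] := IHc (rcons pre d) ([:: DECJZ 2 (size pre)] ++ post).
  have [n2 H2] := IHl pre post.
  have Eprog : prog = rcons pre d ++ code c (size (rcons pre d)) ++
                      [:: DECJZ 2 (size pre)] ++ post.
    by rewrite /prog size_rcons cat_rcons /= -/k -/d -catA.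
  exists (1 + (n1 + (1 + n2))) => fuel.
  rewrite -addnA add1n [LHS]/= {1}/prog size_cat /= addnS ltnS leq_addr.
  rewrite {1}/prog nth_cat ltnn subnn /= (negbTE gn0) -!addnA.
  rewrite (upd_map predn).
  have Hlt : (size pre).+1 + k < size prog.
    by rewrite Eprog !size_cat size_rcons -/k /=; lia.
  have Hnth : nth (INC 0) prog ((size pre).+1 + k) = DECJZ 2 (size pre).
    rewrite Eprog nth_cat size_rcons ltnNge leq_addr /= addKn.
    by rewrite nth_cat ltnn subnn.
  have := H1 (1 + (n2 + fuel)); rewrite -Eprog size_rcons => ->.
  by rewrite -/k add1n [LHS]/= Hlt Hnth g10 eqxx H2.
Qed.

(** * The binary encoding of counter machine programs *)

Definition enc_instr (i : instr) : seq bool :=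
  match i with
  | INC r => [:: true, false & nseq r true ++ [:: false]]
  | DECJZ r j => [:: true, true & nseq r true ++ false :: nseq j true ++ [:: false]]
  end.

Definition enc_prog (p : seq instr) : seq bool :=
  flatten (map enc_instr p) ++ [:: false].

Lemma parse_unary_nseq k t : parse_unary (nseq k true ++ false :: t) = Some (k, t).
Proof. by elim: k => //= k ->. Qed.

Lemma parse_unaryE s k t :
  parse_unary s = Some (k, t) -> s = nseq k true ++ false :: t.
Proof.
elim: s k => //= [[]] s IH k; last by case=> <- ->.
by case E: (parse_unary s) => [[k' t']|] // [<- Et]; rewrite (IH k') //= E Et.
Qed.

Lemma parse_enc_prog p r f : size p < f -> parse_prog f (enc_prog p ++ r) = Some (p, r).
Proof.
rewrite /enc_prog; elim: p f => [|i p IH] [|f] //= ltf.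
have := IH f ltf; rewrite -catA /= => {}IH.
case: i => [k|k j]; rewrite /= -!catA /= ?parse_unary_nseq ?IH //.
by rewrite -!catA /= parse_unary_nseq IH.
Qed.

(** Together with [parse_enc_prog], this lets every string accepted by the parser be treated as an
    encoded program followed by data. *)
Lemma parse_progE f s p r : parse_prog f s = Some (p, r) -> s = enc_prog p ++ r.
Proof.
rewrite /enc_prog; elim: f s p r => //= f IH [//|[] [//|b s]] p r; last first.
- by case=> <- <-.
- by case=> <- <-.
case: b.
- case E1: (parse_unary s) => [[k t1]|] //; case E2: (parse_unary t1) => [[j t2]|] //.
  case E3: (parse_prog f t2) => [[p' r']|] // [<- <-] /=.
  by rewrite (parse_unaryE E1) (parse_unaryE E2) (IH _ _ _ E3) -?catA /= -?catA.
- case E1: (parse_unary s) => [[k t1]|] //.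
  case E3: (parse_prog f t1) => [[p' r']|] // [<- <-] /=.
  by rewrite (parse_unaryE E1) (IH _ _ _ E3) -?catA /= -?catA.
Qed.

Lemma size_enc_prog p : size p < size (enc_prog p).
Proof.
rewrite /enc_prog size_cat addn1 ltnS; elim: p => //= i p IH; rewrite size_cat.
by case: i => /= *; lia.
Qed.

Lemma runs_outputs c r v g :
  runs c (init_regs r v) g ->
  outputs (true :: enc_prog (code c 0) ++ r) v (bits_of_nat (g 0)).
Proof.
move=> bc; have [n Hn] := code_exec bc [::] [::].
(* The extra unit of fuel is spent on noticing that the program counter has left the program. *)
exists (n + 1); rewrite /run_U parse_enc_prog; last first.
  by rewrite size_cat ltnS (leq_trans (ltnW (size_enc_prog _))) ?leq_addr.
by rewrite /= cats0 in Hn; rewrite Hn /= add0n ltnn.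
Qed.

(* [rho] lists the registers holding the environment, [s] is the first free register
   and receives the result; everything below [s] is left unchanged. *)
Definition computable (f : seq nat -> nat) := exists c : seq nat -> nat -> cmd,
  forall rho s g, all (fun r => r < s) rho -> 2 < s -> g 2 = 0 ->
  exists g', [/\ runs (c rho s) g g', g' s = f (map g rho) &
                forall r, r < s -> g' r = g r].

Lemma comp_ext f f' : f =1 f' -> computable f -> computable f'.
Proof.
by move=> ff [c Hc]; exists c => rho s g h1 h2 h3; rewrite -ff; apply: Hc.
Qed.

Definition clear r := Loop r Skip.

Lemma runs_clear r g : r != 2 -> g 2 = 0 -> runs (clear r) g (upd g r 0).
Proof.
move=> r2; move En: (g r) => n; elim: n g En => [|n IH] g En g2.
  have -> : upd g r 0 = g; last exact: RunsLoop0.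
  by apply: functional_extensionality => i; rewrite /upd; case: eqP => // ->.
have -> : upd g r 0 = upd (upd g r n) r 0.
  by apply: functional_extensionality => i; rewrite /upd; case: eqP.
have Eg : upd g r (g r).-1 = upd g r n by rewrite En.
have g2' : upd g r n 2 = 0 by rewrite upd_other // eq_sym.
apply: (RunsLoopS (g1 := upd g r n)); rewrite ?Eg ?En //; first exact: RunsSkip.
by apply: IH; rewrite ?upd_same.
Qed.

Lemma runs_add r q g : r != q -> r != 2 -> q != 2 -> g 2 = 0 ->
  runs (Loop r (Inc q)) g (upd (upd g r 0) q (g q + g r)).
Proof.
move=> rq r2 q2; move En: (g r) => n; elim: n g En => [|n IH] g En g2.
  have -> : upd (upd g r 0) q (g q + 0) = g; last exact: RunsLoop0.
  apply: functional_extensionality => i; rewrite /upd; case: eqP => [->|_].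
    by rewrite addn0.
  by case: eqP => // ->.
set g1 := upd (upd g r n) q (g q).+1.
have -> : upd (upd g r 0) q (g q + n.+1) = upd (upd g1 r 0) q (g1 q + n).
  apply: functional_extensionality => i; rewrite /g1 /upd eqxx.
  by case: eqP => // _; [rewrite addnS | case: eqP].
have g12 : g1 2 = 0 by rewrite /g1 !upd_other 1?eq_sym.
apply: (RunsLoopS (g1 := g1)) => //; first by rewrite En.
  have -> : g1 = upd (upd g r (g r).-1) q (upd g r (g r).-1 q).+1.
    by rewrite En /= [upd g r n q]upd_other // eq_sym.
  exact: RunsInc.
by apply: IH => //; rewrite /g1 upd_other // upd_same.
Qed.

Definition move q r := Seq (clear r) (Loop q (Inc r)).

Lemma runs_move q r g : q != r -> q != 2 -> r != 2 -> g 2 = 0 ->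
  runs (move q r) g (upd (upd g q 0) r (g q)).
Proof.
move=> qr q2 r2 g2; have b1 := runs_clear r2 g2.
have g12 : upd g r 0 2 = 0 by rewrite upd_other // eq_sym.
apply: RunsSeq b1 _; have := runs_add qr q2 r2 g12.
rewrite upd_same add0n upd_other //; congr (runs _ _ _).
by apply: functional_extensionality => i; rewrite /upd; do 2!case: eqP => //.
Qed.

(** Reading a register destroys it, so its content goes to two registers at once; a copy results
    when one of them is moved back. *)
Lemma runs_add2 r p q g : uniq [:: 2; r; p; q] -> g 2 = 0 ->
  runs (Loop r (Seq (Inc p) (Inc q))) g
    (upd (upd (upd g r 0) p (g p + g r)) q (g q + g r)).
Proof.
rewrite /= !inE !negb_or -!andbA andbT => /and5P[r2 p2 q2 rp /andP[rq pq]].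
move En: (g r) => n; elim: n g En => [|n IH] g En g2.
  have -> : upd (upd (upd g r 0) p (g p + 0)) q (g q + 0) = g; last exact: RunsLoop0.
  by apply: functional_extensionality => i; rewrite /upd; case: eqP => [->|_];
    rewrite ?addn0 //; case: eqP => [->|_]; rewrite ?addn0 //; case: eqP => // ->.
set g1 := upd (upd (upd g r n) p (g p).+1) q (g q).+1.
have -> : upd (upd (upd g r 0) p (g p + n.+1)) q (g q + n.+1) =
          upd (upd (upd g1 r 0) p (g1 p + n)) q (g1 q + n).
  apply: functional_extensionality => i; rewrite /g1 /upd !eqxx (negbTE pq) ?addnS.
  by do 3!case: eqP => //.
apply: (RunsLoopS (g1 := g1)); rewrite ?En //.
- apply: RunsSeq; first exact: RunsInc.
  have -> : g1 = upd (upd (upd g r n) p (upd g r n p).+1) q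
                   (upd (upd g r n) p (upd g r n p).+1 q).+1.
    by rewrite /g1 [upd g r n p]upd_other 1?eq_sym // !upd_other // eq_sym.
  exact: RunsInc.
- by rewrite /g1 !upd_other.
- by apply: IH; rewrite /g1 2?upd_other ?upd_same // upd_other.
Qed.

Lemma map_frame (g g' : nat -> nat) s rho :
  all (fun r => r < s) rho -> (forall r, r < s -> g' r = g r) ->
  map g' rho = map g rho.
Proof. by move=> /allP rs fr; apply/eq_in_map => r /rs; apply: fr. Qed.

Lemma all_ltn_leq s s' rho :
  s <= s' -> all (fun r => r < s) rho -> all (fun r => r < s') rho.
Proof. by move=> ss; apply: sub_all => r /leq_trans; apply. Qed.

(* Copying goes through the scratch register [s.+1]. *)
Lemma comp_var i : computable (fun e => nth 0 e i).
Proof.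
exists (fun rho s => if i < size rho then
   Seq (Seq (clear s) (clear s.+1))
    (Seq (Loop (nth 0 rho i) (Seq (Inc s) (Inc s.+1))) (Loop s.+1 (Inc (nth 0 rho i))))
  else clear s) => rho s g rs s2 g2.
have s2n : s != 2 by rewrite gtn_eqF.
have s2n' : s.+1 != 2 by rewrite gtn_eqF // ltnW.
case: ltnP => [li|gi]; last first.
  exists (upd g s 0); split; [exact: runs_clear | |].
    by rewrite nth_default ?size_map // upd_same.
  by move=> r rls; rewrite upd_other // ltn_eqF.
rewrite (nth_map 0) //; move: (nth 0 rho i) (all_nthP 0 rs i li) => r rls.
(* [runs_add2] excludes register 2 as a source; it holds 0, so both copying loops exit at once. *)
have [r2|r2] := eqVneq r 2.
  rewrite r2 g2 in rls *; exists (upd (upd g s 0) s.+1 0).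
  have g2' : upd g s 0 2 = 0 by rewrite upd_other // eq_sym.
  have g2'' : upd (upd g s 0) s.+1 0 2 = 0 by rewrite upd_other // eq_sym.
  split; first apply: RunsSeq.
  - by apply: RunsSeq; apply: runs_clear.
  - by apply: RunsSeq; apply: RunsLoop0; rewrite // upd_same.
  - by rewrite upd_other ?upd_same // ltn_eqF.
  - by move=> q qs; rewrite !upd_other // ltn_eqF // ltnW.
set g1 := upd (upd g s 0) s.+1 0.
have g12 : g1 2 = 0 by rewrite /g1 !upd_other // eq_sym.
have u : uniq [:: 2; r; s; s.+1] by rewrite /= !inE; lia.
have b2 := runs_add2 u g12; set g2' := upd _ s.+1 _ in b2.
have e2 : g2' 2 = 0 by rewrite /g2' !upd_other // eq_sym.
have rs1 : s.+1 != r by rewrite gtn_eqF // ltnW.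
have b3 := runs_add rs1 s2n' r2 e2.
eexists; split; first apply: RunsSeq (RunsSeq b2 b3).
- by apply: RunsSeq; apply: runs_clear => //; rewrite upd_other // eq_sym.
- by rewrite /g2' /g1 /upd !eqxx; do !case: eqP => //; lia.
- by move=> q qs; rewrite /g2' /g1 /upd !eqxx; do !case: eqP => //; try lia; move=> *; subst.
Qed.

Lemma comp0 : computable (fun=> 0).
Proof.
exists (fun _ s => clear s) => rho s g rs s2 g2; exists (upd g s 0).
split; [by apply: runs_clear; rewrite // gtn_eqF | exact: upd_same |].
by move=> r rs'; rewrite upd_other // ltn_eqF.
Qed.

Lemma compS f : computable f -> computable (fun e => (f e).+1).
Proof.
case=> c Hc; exists (fun rho s => Seq (c rho s) (Inc s)) => rho s g rs s2 g2.
have [g' [b e fr]] := Hc rho s g rs s2 g2.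
exists (upd g' s (g' s).+1); split; [exact: RunsSeq b (RunsInc _ _) | |].
  by rewrite upd_same e.
by move=> r rs'; rewrite upd_other ?fr // ltn_eqF.
Qed.

Lemma comp_behead f : computable f -> computable (fun e => f (behead e)).
Proof.
case=> c Hc; exists (fun rho => c (behead rho)) => rho s g rs s2 g2.
have -> : behead (map g rho) = map g (behead rho) by case: (rho).
apply: Hc => //.
by case: rho rs => //= a rho /andP[].
Qed.

Lemma comp_skip f : computable f ->
  computable (fun e => f (nth 0 e 0 :: behead (behead e))).
Proof.
(* The default register 2 holds 0, in agreement with the default value of [nth 0 e 0]. *)
case=> c Hc; exists (fun rho => c (nth 2 rho 0 :: behead (behead rho))) => rho s g rs s2 g2.
have [|g' [b e fr]] := Hc (nth 2 rho 0 :: behead (behead rho)) s g _ s2 g2.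
  by case: rho rs => [|a [|a' rho]] /=; rewrite ?s2 // => /and3P[-> _].
exists g'; split=> //; rewrite e.
by case: rho {rs b e} => [|a [|a' rho]] //=; rewrite g2.
Qed.

(** Register [s] counts the remaining rounds, [s.+1] the completed ones, and [s.+2] holds the
    current value; the step finds the last two at the head of its environment and writes to
    [s.+3]. *)
Lemma comp_rec n x st : computable n -> computable x ->
  computable (fun e => st (nth 0 e 0) (nth 0 e 1) (behead (behead e))) ->
  computable (fun e => nat_rect (fun=> nat) (x e) (fun i y => st y i e) (n e)).
Proof.
case=> [cn Hn] [cx Hx] [cst Hst].
pose body rho s := Seq (cst [:: s.+2, s.+1 & rho] s.+3)
  (Seq (move s.+3 s.+2) (Inc s.+1)).
exists (fun rho s => Seq (cn rho s) (Seq (clear s.+1) (Seq (cx rho s.+2)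
   (Seq (Loop s (body rho s)) (move s.+2 s))))) => rho s g rs s2 g2.
set R := nat_rect _ _ _.
have loopP k i g1 : g1 s = k -> g1 s.+1 = i -> g1 s.+2 = R i ->
    (forall r, r < s -> g1 r = g r) ->
    exists g', [/\ runs (Loop s (body rho s)) g1 g', g' s.+2 = R (i + k) &
                  forall r, r < s -> g' r = g r].
  elim: k i g1 => [|k IH] i g1 Ek Ei ER fr.
    by exists g1; rewrite addn0; split=> //; apply: RunsLoop0.
  have rs' : all (fun r => r < s.+3) [:: s.+2, s.+1 & rho].
    by rewrite /= ltnSn ltnW ?(all_ltn_leq _ rs) //; lia.
  set g1' := upd g1 s (g1 s).-1.
  have g1'2 : g1' 2 = 0 by rewrite /g1' upd_other ?fr // ltn_eqF.
  have [|g3 [b3 e3 fr3]] := Hst _ s.+3 g1' rs' _ g1'2; first by lia.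
  have g32 : g3 2 = 0 by rewrite fr3 //; lia.
  have b4 : runs (move s.+3 s.+2) g3 (upd (upd g3 s.+3 0) s.+2 (g3 s.+3)).
    by apply: runs_move => //; lia.
  set g4 := upd _ s.+2 _ in b4.
  set g5 := upd g4 s.+1 (g4 s.+1).+1.
  have b5 : runs (body rho s) g1' g5 by apply: RunsSeq b3 (RunsSeq b4 (RunsInc _ _)).
  have fr5 r : r < s -> g5 r = g r.
    by move=> rls; rewrite /g5 /g4 !upd_other ?fr3 /g1' ?upd_other ?fr; lia.
  have Es : g5 s = k.
    by rewrite /g5 /g4 !upd_other ?fr3 /g1' ?upd_same ?Ek; lia.
  have Es1 : g5 s.+1 = i.+1.
    rewrite /g5 upd_same /g4 !upd_other ?fr3 /g1'; try lia.
    by rewrite upd_other ?Ei; lia.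
  have Es2 : g5 s.+2 = R i.+1.
    rewrite /g5 /g4 upd_other ?upd_same ?e3; last by lia.
    rewrite /= /g1' !upd_other ?Ei ?ER /=; try lia.
    by congr st; apply: map_frame rs _ => r rls; rewrite upd_other ?fr; lia.
  have [g' [b' e' fr']] := IH _ _ Es Es1 Es2 fr5.
  exists g'; split=> //; last by rewrite addnS -addSn.
  by apply: RunsLoopS b5 _ b'; rewrite ?Ek ?fr5.
have [gn [bn en frn]] := Hn rho s g rs s2 g2.
have gn2 : gn 2 = 0 by rewrite frn.
set gc := upd gn s.+1 0.
have bc : runs (clear s.+1) gn gc by apply: runs_clear => //; lia.
have gc2 : gc 2 = 0 by rewrite /gc upd_other //; lia.
have rs2 : all (fun r => r < s.+2) rho by apply: all_ltn_leq rs; lia.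
have [|gx [bx ex frx]] := Hx rho s.+2 gc rs2 _ gc2; first by lia.
have frcx r : r < s -> gx r = g r.
  by move=> rls; rewrite frx /gc ?upd_other ?frn; lia.
have [||||g' [b' e' fr']] := loopP (n (map g rho)) 0 gx.
- rewrite frx; last by lia.
  by rewrite /gc upd_other; [exact: en | lia].
- rewrite frx; last by lia.
  by rewrite /gc upd_same.
- rewrite ex /R /=; congr (x _); apply: map_frame rs _ => r rls.
  by rewrite /gc upd_other ?frn; lia.
- exact: frcx.
have bm : runs (move s.+2 s) g' (upd (upd g' s.+2 0) s (g' s.+2)).
  by apply: runs_move; rewrite ?fr' //; lia.
eexists; split; first exact: RunsSeq bn (RunsSeq bc (RunsSeq bx (RunsSeq b' bm))).
  by rewrite upd_same e' add0n.
by move=> r rls; rewrite !upd_other ?fr'; lia.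
Qed.

(** * Closure properties of computable functions *)

(** Inside a recursion or a bounded search the outer functions are applied to a tail of the extended
    environment; such tails are the weakenings that [comp_weakening] recognizes. *)
Definition weakening (w : seq nat -> seq nat) :=
  forall f, computable f -> computable (fun e => f (w e)).

Lemma weak_id : weakening id. Proof. by []. Qed.

Lemma weak_behead w : weakening w -> weakening (fun e => behead (w e)).
Proof. by move=> H f /comp_behead/H. Qed.

Lemma comp_weak f w : computable f -> weakening w -> computable (fun e => f (w e)).
Proof. by move=> cf; apply. Qed.

Lemma comp_const n : computable (fun=> n).
Proof. by elim: n => [|n]; [exact: comp0 | exact: compS]. Qed.

Ltac comp_weakening :=
  first [exact weak_id | apply weak_behead; comp_weakening].

Ltac comp_leaf :=
  match goal with
  | H : computable ?f |- computable (fun e => ?f (@?w e)) =>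
      apply (comp_weak (w := w) H); comp_weakening
  | H : computable (fun e => nat_of_bool (?f e))
    |- computable (fun e => nat_of_bool (?f (@?w e))) =>
      apply (comp_weak (w := w) H); comp_weakening
  | |- computable (fun e => nth 0 (@?w e) ?i) =>
      apply (comp_weak (w := w) (comp_var i)); comp_weakening
  | |- computable (fun=> _) => apply comp_const
  | |- _ => assumption
  end.

Ltac comp_base := repeat first [comp_leaf | apply compS].

Lemma comp_pred f : computable f -> computable (fun e => (f e).-1).
Proof.
move=> cf; apply: (@comp_ext (fun e => nat_rect (fun=> nat) 0 (fun i _ => i) (f e))).
  by move=> e /=; case: (f e).
by apply: (comp_rec (st := fun _ i _ => i)); comp_base.
Qed.

Lemma comp_add f g : computable f -> computable g -> computable (fun e => f e + g e).
Proof.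
move=> cf cg.
apply: (@comp_ext (fun e => nat_rect (fun=> nat) (f e) (fun _ y => y.+1) (g e))).
  by move=> e /=; elim: (g e) => [|n /= ->]; rewrite ?addn0 ?addnS.
by apply: (comp_rec (st := fun y _ _ => y.+1)); comp_base.
Qed.

Lemma comp_mul f g : computable f -> computable g -> computable (fun e => f e * g e).
Proof.
move=> cf cg.
apply: (@comp_ext (fun e => nat_rect (fun=> nat) 0 (fun _ y => f e + y) (g e))).
  by move=> e /=; elim: (g e) => [|n /= ->]; rewrite ?muln0 ?mulnS.
by apply: (comp_rec (st := fun y _ e => f e + y)); try apply: comp_add; comp_base.
Qed.

Lemma comp_exp f g : computable f -> computable g -> computable (fun e => f e ^ g e).
Proof.
move=> cf cg.
apply: (@comp_ext (fun e => nat_rect (fun=> nat) 1 (fun _ y => f e * y) (g e))).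
  by move=> e /=; elim: (g e) => [|n /= ->]; rewrite ?expn0 ?expnS.
by apply: (comp_rec (st := fun y _ e => f e * y)); try apply: comp_mul; comp_base.
Qed.

Lemma comp_sub f g : computable f -> computable g -> computable (fun e => f e - g e).
Proof.
move=> cf cg.
apply: (@comp_ext (fun e => nat_rect (fun=> nat) (f e) (fun _ y => y.-1) (g e))).
  by move=> e /=; elim: (g e) => [|n /= ->]; rewrite ?subn0 ?subnS.
by apply: (comp_rec (st := fun y _ e => y.-1)); try apply: comp_pred; comp_base.
Qed.

Lemma comp_if (b : seq nat -> bool) f g :
  computable (fun e => b e) -> computable f -> computable g ->
  computable (fun e => if b e then f e else g e).
Proof.
move=> cb cf cg.
apply: (@comp_ext (fun e => nat_rect (fun=> nat) (g e) (fun _ _ => f e) (b e))).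
  by move=> e /=; case: (b e).
by apply: (comp_rec (st := fun y _ e => f e)); comp_base.
Qed.

Lemma comp_neg (b : seq nat -> bool) : computable (fun e => b e) -> computable (fun e => ~~ b e).
Proof.
move=> cb; apply: (@comp_ext (fun e => if b e then 0 else 1)).
  by move=> e; case: (b e).
by apply: comp_if; comp_base.
Qed.

Lemma comp_and (b c : seq nat -> bool) : computable (fun e => b e) -> computable (fun e => c e) ->
  computable (fun e => b e && c e).
Proof.
move=> cb cc; apply: (@comp_ext (fun e => if b e then c e : nat else 0)).
  by move=> e; case: (b e).
by apply: comp_if; comp_base.
Qed.

Lemma comp_leq f g : computable f -> computable g -> computable (fun e => f e <= g e).
Proof.
move=> cf cg; apply: (@comp_ext (fun e => 1 - (f e - g e))).
  by move=> e; rewrite /leq; case: (f e - g e) => [|n] //=; lia.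
by apply: comp_sub; [|apply: comp_sub]; comp_base.
Qed.

Lemma comp_eq f g : computable f -> computable g -> computable (fun e => f e == g e).
Proof.
move=> cf cg; apply: (@comp_ext (fun e => (f e <= g e) && (g e <= f e))).
  by move=> e; rewrite eqn_leq.
by apply: comp_and; apply: comp_leq.
Qed.

Lemma nth1_behead (e : seq nat) : nth 0 (behead e) 0 = nth 0 e 1.
Proof. by case: e. Qed.

Lemma find_iotaS P n : find P (iota 0 n.+1) =
  if find P (iota 0 n) < n then find P (iota 0 n) else if P n then n else n.+1.
Proof.
rewrite -addn1 iotaD find_cat size_iota has_find size_iota /= add0n.
by case: ltnP => // _; case: (P n); rewrite ?addn0 ?addn1.
Qed.

Lemma find_iota P n k : k <= n -> (forall i, i < k -> ~~ P i) -> (k < n -> P k) ->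
  find P (iota 0 n) = k.
Proof.
elim: n k => [|n IH] k kn lt Pk; first by move: kn; rewrite leqn0 => /eqP.
rewrite find_iotaS; have [ltkn|] := ltnP k n.+1; last first.
  move=> gtkn; have Ek : k = n.+1 by lia.
  by rewrite (IH n) ?ltnn ?(negbTE (lt n _)) ?Ek // => i ltin; apply: lt; lia.
rewrite (IH k) // => [|_]; last exact: Pk.
by case: ltnP => // lenk; have <- : k = n by [lia]; rewrite Pk.
Qed.

Lemma comp_iter n x (st : nat -> seq nat -> nat) : computable n -> computable x ->
  computable (fun e => st (nth 0 e 0) (behead e)) ->
  computable (fun e => iter (n e) (fun y => st y e) (x e)).
Proof.
move=> cn cx cst.
apply: (@comp_ext (fun e => nat_rect (fun=> nat) (x e) (fun _ y => st y e) (n e))).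
  by move=> e; elim: (n e) => //= k ->.
by apply: (comp_rec (st := fun y _ e => st y e)) => //; apply: comp_skip cst.
Qed.

(** The recursion keeps [y = i] while no index below [i] has passed the test; [y < i] is the index
    found, which is then kept. *)
Lemma comp_find n (P : nat -> seq nat -> bool) : computable n ->
  computable (fun e => P (nth 0 e 0) (behead e)) ->
  computable (fun e => find (fun i => P i e) (iota 0 (n e))).
Proof.
move=> cn /comp_behead cP.
have {}cP : computable (fun e => P (nth 0 e 1) (behead (behead e))).
  by apply: comp_ext cP => e; rewrite nth1_behead.
apply: (@comp_ext (fun e => nat_rect (fun=> nat) 0
    (fun i y => if y < i then y else if P i e then i else i.+1) (n e))).
  by move=> e; elim: (n e) => // k IH; rewrite find_iotaS -IH.
apply: (comp_rec (st := fun y i e => if y < i then y else if P i e then i else i.+1)).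
- exact: cn.
- exact: comp0.
- apply: comp_if; [apply: comp_leq; comp_base | comp_base | by apply: comp_if; comp_base].
Qed.

Lemma comp_all n (P : nat -> seq nat -> bool) : computable n ->
  computable (fun e => P (nth 0 e 0) (behead e)) ->
  computable (fun e => all (fun i => P i e) (iota 0 (n e))).
Proof.
move=> cn cP; apply: (@comp_ext (fun e => n e <= find (fun i => ~~ P i e) (iota 0 (n e)))).
  by move=> e; rewrite -[all _ _]negbK -has_predC has_find size_iota -leqNgt.
apply: comp_leq => //; apply: (comp_find (P := fun i e => ~~ P i e)) => //.
exact: comp_neg.
Qed.

Lemma comp_has n (P : nat -> seq nat -> bool) : computable n ->
  computable (fun e => P (nth 0 e 0) (behead e)) ->
  computable (fun e => has (fun i => P i e) (iota 0 (n e))).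
Proof.
move=> cn cP; apply: (@comp_ext (fun e => find (fun i => P i e) (iota 0 (n e)) < n e)).
  by move=> e; rewrite has_find size_iota.
by apply: comp_leq => //; apply: compS; apply: comp_find.
Qed.

Lemma comp_div f g : computable f -> computable g -> computable (fun e => f e %/ g e).
Proof.
(* The search alone would return [f e] for divisor 0, where division gives 0. *)
move=> cf cg; apply: (@comp_ext (fun e => if g e == 0 then 0 else
    find (fun q => f e < q.+1 * g e) (iota 0 (f e)))).
  move=> e; move: (f e) (g e) => m d; case: eqP => [->|/eqP d0]; first by rewrite divn0.
  have d_gt0 : 0 < d by rewrite lt0n.
  apply: find_iota => [|i|_]; first exact: leq_div.
    by rewrite leq_divRL // leqNgt.
  by rewrite ltn_ceil.
apply: comp_if; [apply: comp_eq; comp_base | comp_base |].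
apply: (comp_find (P := fun q e => f e < q.+1 * g e)); comp_base.
by apply: comp_leq; [|apply: comp_mul]; comp_base.
Qed.

Lemma comp_mod f g : computable f -> computable g -> computable (fun e => f e %% g e).
Proof.
move=> cf cg; apply: (@comp_ext (fun e => f e - f e %/ g e * g e)).
  by move=> e; rewrite {1}(divn_eq (f e) (g e)) addKn.
by apply: comp_sub => //; apply: comp_mul => //; apply: comp_div.
Qed.

Ltac comp_step :=
  match goal with
  | |- computable (fun e => S _) => apply compS
  | |- computable (fun e => predn _) => apply comp_pred
  | |- computable (fun e => addn _ _) => apply comp_add
  | |- computable (fun e => muln _ _) => apply comp_mul
  | |- computable (fun e => expn _ _) => apply comp_exp
  | |- computable (fun e => subn _ _) => apply comp_sub
  | |- computable (fun e => divn _ _) => apply comp_div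
  | |- computable (fun e => modn _ _) => apply comp_mod
  | |- computable (fun e => if _ then _ else _) => apply comp_if
  | |- computable (fun e => nat_of_bool (~~ _)) => apply comp_neg
  | |- computable (fun e => nat_of_bool (_ && _)) => apply comp_and
  | |- computable (fun e => nat_of_bool (leq _ _)) => apply comp_leq
  | |- computable (fun e => nat_of_bool (_ == _)) => apply comp_eq
  | |- computable (fun e => nat_of_bool (all _ (iota 0 _))) => apply comp_all
  | |- computable (fun e => nat_of_bool (has _ (iota 0 _))) => apply comp_has
  | |- computable (fun e => find _ (iota 0 _)) => apply comp_find
  | |- computable (fun e => iter _ _ _) => apply comp_iter
  end.

Ltac comp_tac := repeat first [comp_leaf | comp_step].

Lemma comp_dvdn f g : computable f -> computable g -> computable (fun e => f e %| g e).
Proof. by move=> cf cg; rewrite /dvdn; comp_tac. Qed.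

Lemma comp_trunc_log f : computable f -> computable (fun e => trunc_log 2 (f e)).
Proof.
move=> cf.
apply: (@comp_ext (fun e => find (fun k => f e < 2 ^ k.+1) (iota 0 (f e)))); last by comp_tac.
move=> e; move: (f e) => m; have [->|m0] := posnP m; first by [].
apply: find_iota => [|i lti|_]; last exact: trunc_log_ltn.
  exact: leq_trans (ltnW (ltn_expl _ (ltnSn 1))) (trunc_logP _ _).
by rewrite -leqNgt (leq_trans _ (trunc_logP (ltnSn 1) m0)) // leq_exp2l.
Qed.

Lemma comp_logn p f : prime p -> computable f -> computable (fun e => logn p (f e)).
Proof.
move=> pp cf.
apply: (@comp_ext (fun e => find (fun k => ~~ (p ^ k.+1 %| f e)) (iota 0 (f e)))).
  move=> e; move: (f e) => m; have [->|m0] := posnP m; first by rewrite logn0.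
  apply: find_iota => [|i lti|_]; rewrite ?negbK ?pfactor_dvdn ?ltnn //.
  by rewrite ltnW // ltn_logl.
by comp_tac; apply: comp_dvdn; comp_tac.
Qed.

(** * Unbounded search and binary strings *)

(** This adds unbounded search to the primitive recursive functions. The data [r] follow the fixed
    code [q], so a description by [r] costs only a constant more than its length. *)
Lemma search_program (P : seq nat -> bool) g :
  computable (fun e => P e) -> computable g ->
  exists q, forall r v m,
    let env i := [:: i; nat_of_bits r; nat_of_bits v] in
    P (env m) -> (forall i, i < m -> ~~ P (env i)) ->
    outputs (true :: q ++ r) v (bits_of_nat (g (env m))).
Proof.
move=> /comp_neg[cP HP] [cg Hg].
(* Register 3 holds the search index; 0 and 1 hold the numbers of [r] and [v] from the start;
   register 4 receives the negated test, so the loop on it runs until [P] holds. *)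
pose rho := [:: 3; 0; 1].
pose loop := Loop 4 (Seq (Inc 3) (cP rho 4)).
exists (enc_prog (code (Seq (cP rho 4) (Seq loop (Seq (cg rho 4) (move 4 0)))) 0)).
move=> r v m env Pm Pi.
have rs : all (fun r => r < 4) rho by [].
pose inv i (h : nat -> nat) :=
  [/\ h 0 = nat_of_bits r, h 1 = nat_of_bits v, h 2 = 0 & h 3 = i].
have invE i h : inv i h -> map h rho = env i by case=> e0 e1 e2 e3; rewrite /= e0 e1 e3.
have stepP i h : inv i h -> exists h', [/\ runs (cP rho 4) h h', h' 4 = ~~ P (env i) & inv i h'].
  move=> ih; have [_ _ h2 _] := ih; have [h' [b e fr]] := HP rho 4 h rs isT h2.
  exists h'; split; rewrite ?e ?(invE i) //.
  by case: ih => *; split; rewrite fr.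
have loopP k i h : i + k = m -> inv i h -> h 4 = ~~ P (env i) ->
    exists h', runs loop h h' /\ inv m h'.
  elim: k i h => [|k IH] i h.
    by rewrite addn0 => -> ih h4; exists h; split=> //; apply: RunsLoop0; rewrite h4 Pm.
  move=> ik ih h4; have /Pi Pni : i < m by lia.
  pose h1 := upd (upd h 4 (h 4).-1) 3 (upd h 4 (h 4).-1 3).+1.
  have ih1 : inv i.+1 h1.
    by case: ih => e0 e1 e2 e3; split; rewrite /h1 /upd //= e3.
  have [h2 [b2 e2 ih2]] := stepP _ _ ih1.
  have [|h' [b' ih']] := IH i.+1 h2 _ ih2 e2; first by rewrite addSnnS.
  exists h'; split=> //; apply: RunsLoopS b'; first by rewrite h4 Pni.
    by apply: RunsSeq b2; apply: RunsInc.
  by case: ih2.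
have inv0 : inv 0 (init_regs r v) by [].
have [h1 [b1 e1 ih1]] := stepP _ _ inv0.
have [h2 [b2 ih2]] := loopP m 0 h1 (add0n m) ih1 e1.
have [_ _ h22 _] := ih2; have [h3 [b3 e3 fr3]] := Hg rho 4 h2 rs isT h22.
have h32 : h3 2 = 0 by rewrite fr3.
have bm : runs (move 4 0) h3 (upd (upd h3 4 0) 0 (h3 4)) by apply: runs_move.
have := runs_outputs (RunsSeq b1 (RunsSeq b2 (RunsSeq b3 bm))).
by rewrite upd_same e3 (invE m).
Qed.

Lemma nat_of_bits_rcons s b : nat_of_bits (rcons s b) = (nat_of_bits s).*2 + 1 + b.
Proof. by rewrite /nat_of_bits foldl_rcons. Qed.

Lemma nat_of_bitsK : cancel nat_of_bits bits_of_nat.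
Proof.
have aux f s : nat_of_bits s <= f -> bits_of_nat_aux f (nat_of_bits s) = s.
  elim/last_ind: s f => [|s b IH] [|f] //.
    by rewrite nat_of_bits_rcons addnAC addn1.
  rewrite nat_of_bits_rcons addnAC addn1 ltnS => le /=; rewrite oddD odd_double oddb.
  have -> : ((nat_of_bits s).*2 + b) %/ 2 = nat_of_bits s by case: b {le}; lia.
  by rewrite IH //; lia.
by move=> s; apply: aux.
Qed.

Lemma bits_of_natK : cancel bits_of_nat nat_of_bits.
Proof.
have aux f n : n <= f -> nat_of_bits (bits_of_nat_aux f n) = n.
  elim: f n => [|f IH] [|n] // le; rewrite [bits_of_nat_aux _ _]/= nat_of_bits_rcons.
  rewrite IH; last by rewrite (leq_trans (leq_div _ _)).
  by rewrite divn2; lia.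
by move=> n; apply: aux.
Qed.

Lemma nat_of_bits_cat s t :
  (nat_of_bits (s ++ t)).+1 = nat_of_bits s * 2 ^ size t + (nat_of_bits t).+1.
Proof.
elim/last_ind: t => [|t b IH]; first by rewrite cats0 muln1 addn1.
rewrite -rcons_cat !nat_of_bits_rcons size_rcons expnS; nia.
Qed.

Lemma nat_of_bits_bounds s : 2 ^ size s <= (nat_of_bits s).+1 < 2 ^ (size s).+1.
Proof.
elim/last_ind: s => // s b IH; rewrite nat_of_bits_rcons size_rcons !expnS in IH *.
by case: b; lia.
Qed.

Lemma trunc_log_bits s : trunc_log 2 (nat_of_bits s).+1 = size s.
Proof. exact/trunc_log_eq/nat_of_bits_bounds. Qed.

Lemma size_bits_of_nat n : size (bits_of_nat n) = trunc_log 2 n.+1.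
Proof. by rewrite -{2}[n]bits_of_natK trunc_log_bits. Qed.

Lemma KScond_le p v u : outputs p v u -> KScond u v <= size p.
Proof.
rewrite /KScond => ou; case: ex_minnP => k _; apply.
rewrite /has_prog_of_size /Defs.decP; case: excluded_middle_informative => // nex.
by case: nex; exists p.
Qed.

Lemma KScond_prog u v : exists2 p, outputs p v u & size p = KScond u v.
Proof.
rewrite /KScond; case: ex_minnP => k + _; rewrite /has_prog_of_size /Defs.decP.
by case: excluded_middle_informative => // [[p [sp ou]]] _; exists p.
Qed.

(** * Positions in an encoded program and coded registers *)

(* [x] is the number of a string plus one, that is, its bits preceded by a leading 1.
   A suffix of the string is represented by its length [m]. *)
Definition suffix_of x s := exists q, x = q * 2 ^ size s + (nat_of_bits s).+1.
Definition bit_at x m := x %/ 2 ^ m.-1 %% 2.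
(** The low [m] bits get a leading 1 of their own, and subtracting one returns to the numbering by
    [nat_of_bits]. *)
Definition suffix_val x m := (x %% 2 ^ m + 2 ^ m).-1.
Definition ones x m := find (fun k => bit_at x (m - k) == 0) (iota 0 m).
Definition skip_unary x m := m - (ones x m).+1.
(** After the leading 1 of an instruction the tag 0 announces one unary argument ([INC]), the tag 1
    two ([DECJZ]). The terminating 0 of the code is a fixed point. *)
Definition next_pos x m :=
  if bit_at x m == 0 then m
  else if bit_at x m.-1 == 0 then skip_unary x (m - 2)
  else skip_unary x (skip_unary x (m - 2)).
Definition pos x m k := iter k (fun n => next_pos x n) m.

Lemma suffix_of_all s : suffix_of (nat_of_bits s).+1 s.
Proof. by exists 0. Qed.

Lemma suffix_of_cat x s t : suffix_of x (s ++ t) -> suffix_of x t.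
Proof.
case=> q ->; exists (q * 2 ^ size s + nat_of_bits s).
by rewrite nat_of_bits_cat size_cat expnD mulnDl addnA mulnA.
Qed.

Lemma suffix_of_drop x s i : suffix_of x s -> suffix_of x (drop i s).
Proof. by rewrite -{1}(cat_take_drop i s); apply: suffix_of_cat. Qed.

Lemma suffix_valE x s : suffix_of x s -> suffix_val x (size s) = nat_of_bits s.
Proof.
case=> q ->; have := nat_of_bits_bounds s; rewrite /suffix_val expnS => /andP[le lt].
rewrite modnMDl -[(nat_of_bits s).+1](subnK le) modnDr modn_small; lia.
Qed.

Lemma bit_at_cons x b s : suffix_of x (b :: s) -> bit_at x (size s).+1 = b.
Proof.
case=> q ->; have := nat_of_bits_bounds s; rewrite expnS => /andP[le lt].
rewrite -[nat_of_bits (b :: s)]/(nat_of_bits ([:: b] ++ s)) nat_of_bits_cat /bit_at /= ?expnS.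
have -> : nat_of_bits [:: b] = b.+1 by rewrite /nat_of_bits /=; lia.
rewrite -[(nat_of_bits s).+1](subnK le).
set k := 2 ^ size s in le lt *.
have -> : q * (2 * k) + (b.+1 * k + ((nat_of_bits s).+1 - k + k)) =
          (q.+1 * 2 + b) * k + ((nat_of_bits s).+1 - k) by lia.
rewrite divnMDl ?expn_gt0 // divn_small ?addn0; last by lia.
by rewrite modnMDl modn_small //; case: b.
Qed.

Lemma bit_at_nth x s i : suffix_of x s -> i < size s ->
  bit_at x (size s - i) = nth false s i.
Proof.
move=> xs lti; have := suffix_of_drop i xs; rewrite (drop_nth false) // => /bit_at_cons <-.
by rewrite size_drop -subSn.
Qed.

Lemma ones_nseq x k t : suffix_of x (nseq k true ++ false :: t) ->
  ones x (size (nseq k true ++ false :: t)) = k.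
Proof.
move=> xs; have Es := size_cat (nseq k true) (false :: t); rewrite size_nseq /= in Es.
have ltk : k < size (nseq k true ++ false :: t) by rewrite Es addnS ltnS leq_addr.
apply: find_iota => [|i lti|_]; first exact: ltnW.
  rewrite bit_at_nth ?nth_cat ?size_nseq ?lti ?nth_nseq ?lti //.
  exact: ltn_trans ltk.
by rewrite bit_at_nth // nth_cat size_nseq ltnn subnn.
Qed.

Lemma skip_unary_nseq x k t : suffix_of x (nseq k true ++ false :: t) ->
  skip_unary x (size (nseq k true ++ false :: t)) = size t.
Proof.
move=> xs; rewrite /skip_unary ones_nseq // size_cat size_nseq /=; lia.
Qed.

Lemma next_pos_cons x b s : suffix_of x [:: true, b & s] ->
  next_pos x (size s).+2 =
  if b then skip_unary x (skip_unary x (size s)) else skip_unary x (size s).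
Proof.
move=> xs; have xs' := suffix_of_cat (s := [:: true]) xs.
by rewrite /next_pos (bit_at_cons xs) (bit_at_cons xs') subSS subn1; case: b {xs xs'}.
Qed.

Lemma enc_incE r t : enc_instr (INC r) ++ t = [:: true, false & nseq r true ++ false :: t].
Proof. by rewrite /= -catA. Qed.

Lemma enc_decjzE r j t : enc_instr (DECJZ r j) ++ t =
  [:: true, true & nseq r true ++ false :: nseq j true ++ false :: t].
Proof. by rewrite /= -catA /= -catA. Qed.

Lemma next_pos_instr x i t : suffix_of x (enc_instr i ++ t) ->
  next_pos x (size (enc_instr i ++ t)) = size t.
Proof.
case: i => [r|r j]; rewrite ?enc_incE ?enc_decjzE => xs; rewrite (next_pos_cons xs);
  have {}xs := suffix_of_cat (s := [:: true; _]) xs; rewrite skip_unary_nseq //.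
have {}xs := suffix_of_cat xs; have {}xs := suffix_of_cat (s := [:: false]) xs.
by rewrite skip_unary_nseq.
Qed.

Lemma enc_prog_cons i p : enc_prog (i :: p) = enc_instr i ++ enc_prog p.
Proof. by rewrite /enc_prog /= catA. Qed.

Lemma enc_prog_drop p k : k < size p ->
  enc_prog (drop k p) = enc_instr (nth (INC 0) p k) ++ enc_prog (drop k.+1 p).
Proof. by move=> ltk; rewrite (drop_nth (INC 0)) // enc_prog_cons. Qed.

Lemma suffix_of_enc_drop x p r k : suffix_of x (enc_prog p ++ r) ->
  suffix_of x (enc_prog (drop k p) ++ r).
Proof.
elim: k p => [|k IH] [|i p] //= xs; apply: IH.
by apply: (suffix_of_cat (s := enc_instr i)); rewrite catA -enc_prog_cons.
Qed.

Lemma posE x p r k : suffix_of x (enc_prog p ++ r) ->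
  pos x (size (enc_prog p ++ r)) k = size (enc_prog (drop k p) ++ r).
Proof.
move=> xs; elim: k => [|k IH]; first by rewrite drop0.
rewrite /pos iterS -/(pos _ _ _) IH; have {}xs := suffix_of_enc_drop k xs.
have [ltk|lek] := ltnP k (size p).
  by rewrite enc_prog_drop // -catA next_pos_instr // catA -enc_prog_drop.
rewrite !drop_oversize // 1?ltnW // in xs *; rewrite /next_pos /= in xs *.
by rewrite (bit_at_cons xs).
Qed.

(** Fermat numbers replace the primes in a Gödel numbering of the registers: they have a closed
    form, are pairwise coprime, and being odd leave the factor 2 to the program counter. *)
Definition fermat i := (2 ^ 2 ^ i).+1.

Lemma odd_fermat i : odd (fermat i).
Proof. by rewrite /= oddX /= orbF expn_eq0. Qed.

(** For [i < j], the factorization of [2 ^ 2 ^ m.+1 - 1] as [(2 ^ 2 ^ m - 1) * fermat m] makes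
    [fermat i] a divisor of [fermat j - 2]; a common divisor thus divides 2, but both numbers are
    odd. *)
Lemma coprime_fermat i j : i != j -> coprime (fermat i) (fermat j).
Proof.
wlog ij : i j / i < j => [hwlog ne|_].
  by case: (ltngtP i j) ne => // lt _; [|rewrite coprime_sym]; apply: hwlog; rewrite // ltn_eqF.
have sq m : (2 ^ 2 ^ m.+1).-1 = (2 ^ 2 ^ m).-1 * fermat m.
  rewrite expnS mul2n -addnn expnD /fermat.
  by have := expn_gt0 2 (2 ^ m); case: (2 ^ 2 ^ m) => // n _; nia.
have dv d : fermat i %| (2 ^ 2 ^ (i + d).+1).-1.
  elim: d => [|d IH]; first by rewrite addn0 sq dvdn_mull.
  by rewrite addnS sq dvdn_mulr.
have := dv (j - i.+1); have -> : (i + (j - i.+1)).+1 = j by lia.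
move=> /dvdnP[q Eq]; have -> : fermat j = q * fermat i + 2.
  by rewrite -Eq /fermat addn2 prednK // expn_gt0.
by rewrite /coprime gcdnMDl -/(coprime _ _) coprimen2 odd_fermat.
Qed.

Section Registers.
Variable K : nat.
Implicit Type g : nat -> nat.

Definition regs_code g := \prod_(i < K) fermat i ^ g i.
Definition other_code g r := \prod_(i < K | i != r :> nat) fermat i ^ g i.

Lemma regs_codeD g r : r < K -> regs_code g = fermat r ^ g r * other_code g r.
Proof. by move=> rK; rewrite /regs_code (bigD1 (Ordinal rK)). Qed.

Lemma regs_code_upd g r v : r < K ->
  regs_code (upd g r v) = fermat r ^ v * other_code g r.
Proof.
move=> rK; rewrite (regs_codeD _ rK) upd_same; congr (_ * _).
by apply: eq_bigr => i ir; rewrite upd_other.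
Qed.

Lemma coprime_other_code g r : coprime (fermat r) (other_code g r).
Proof.
apply: (big_ind (coprime (fermat r))) => [|a b ca cb|i ir].
- exact: coprimen1.
- by rewrite coprimeMr ca.
- by rewrite coprimeXr // coprime_fermat // eq_sym.
Qed.

Lemma coprime2_regs_code g : coprime 2 (regs_code g).
Proof.
apply: (big_ind (coprime 2)) => [|a b ca cb|i ir].
- exact: coprimen1.
- by rewrite coprimeMr ca.
- by rewrite coprimeXr // coprime2n odd_fermat.
Qed.

Lemma regs_code_gt0 g : 0 < regs_code g.
Proof. by rewrite prodn_gt0 // => i; rewrite expn_gt0. Qed.

Lemma logn2_regs_code n g : logn 2 (2 ^ n * regs_code g) = n.
Proof.
rewrite lognM ?expn_gt0 ?regs_code_gt0 // pfactorK //.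
by rewrite logn_coprime ?coprime2_regs_code ?addn0.
Qed.

(** [fermat 0] is the prime 3, so the exponent of 3 reads register 0, where the output is. *)
Lemma logn3_regs_code n g : 0 < K -> logn 3 (2 ^ n * regs_code g) = g 0.
Proof.
move=> K0; rewrite lognM ?expn_gt0 ?regs_code_gt0 //.
rewrite logn_coprime ?coprimeXr // (regs_codeD g K0) lognM ?expn_gt0 //; last first.
  by rewrite prodn_gt0 // => i; rewrite expn_gt0.
rewrite (pfactorK (p := 3)) // logn_coprime ?addn0 //.
exact: (coprime_other_code g 0).
Qed.

(** [fermat r] need not be prime, but it is coprime to the rest of the code, so divisibility by it
    serves as the zero test of [DECJZ]. *)
Lemma fermat_dvd_regs_code n g r : r < K ->
  (fermat r %| 2 ^ n * regs_code g) = (g r != 0).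
Proof.
move=> rK; rewrite (regs_codeD g rK) mulnCA.
case Er: (g r) => [|k]; last by rewrite expnS -mulnA dvdn_mulr.
rewrite expn0 mul1n; apply/negbTE/negP => /gcdn_idPl.
have -> : gcdn (fermat r) (2 ^ n * other_code g r) = 1.
  apply/eqP; rewrite -/(coprime _ _) coprimeMr coprime_other_code andbT.
  by rewrite coprimeXr // coprimen2 odd_fermat.
by move=> /eqP; rewrite eqSS eq_sym expn_eq0.
Qed.

End Registers.

(** * The interpreter *)

(* The configuration with program counter [pc] and registers [g] is coded by
   [2 ^ pc * regs_code K g]; [n] is the position of the current instruction. *)
Definition step_at x n S :=
  if bit_at x n == 0 then S
  else if bit_at x n.-1 == 0 then 2 * (fermat (ones x (n - 2)) * S)
  else if fermat (ones x (n - 2)) %| S then 2 * (S %/ fermat (ones x (n - 2)))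
  else S %/ 2 ^ logn 2 S * 2 ^ ones x (skip_unary x (n - 2)).
Definition step x m S := step_at x (pos x m (logn 2 S)) S.
Definition halted x m S := bit_at x (pos x m (logn 2 S)) == 0.

(** The terminating 0 is reached after at most [m] instructions, and the data follow it. The bases 3
    and 5 are [fermat 0] and [fermat 1], for the registers 0 and 1. *)
Definition start x v m := 3 ^ suffix_val x (pos x m m).-1 * 5 ^ v.
Definition config x v m t := iter t (fun S => step x m S) (start x v m).

(* [uni p v t] is [0] if the program numbered [p] has not stopped on input [v] by time [t],
   and one plus the number of its output otherwise. *)
Definition uni p v t :=
  if bit_at p.+1 (trunc_log 2 p.+1) == 0
  then (suffix_val p.+1 (trunc_log 2 p.+1).-1).+1
  else if halted p.+1 (trunc_log 2 p.+1).-1 (config p.+1 v (trunc_log 2 p.+1).-1 t)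
  then (logn 3 (config p.+1 v (trunc_log 2 p.+1).-1 t)).+1 else 0.

Lemma step_halted x m S : halted x m S -> step x m S = S.
Proof. by rewrite /halted /step /step_at => ->. Qed.

Lemma uni_mono p v t t' y : t <= t' -> uni p v t = y.+1 -> uni p v t' = y.+1.
Proof.
move=> /subnK <-; elim: (t' - t) => // k IH /IH; rewrite addSn /uni.
case: ifP => // _; case: ifP => // h <-.
by rewrite /config iterS -/(config _ _ _ _) step_halted // h.
Qed.

Lemma uni_fun p v t t' y y' : uni p v t = y.+1 -> uni p v t' = y'.+1 -> y = y'.
Proof.
move=> /(uni_mono (leq_maxl t t')) e /(uni_mono (leq_maxr t t')).
by rewrite e => -[].
Qed.

Definition reg_of i := match i with INC r => r | DECJZ r _ => r end.

Section Simulation.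
Variables (x K : nat) (prog : seq instr) (r : seq bool).
Hypothesis xs : suffix_of x (enc_prog prog ++ r).
Hypothesis regsK : all (fun i => reg_of i < K) prog.
Let m := size (enc_prog prog ++ r).
Let conf pc g := 2 ^ pc * regs_code K g.

Lemma conf_pos pc g :
  pos x m (logn 2 (conf pc g)) = size (enc_prog (drop pc prog) ++ r).
Proof. by rewrite logn2_regs_code posE. Qed.

Lemma conf_end pc g : size prog <= pc -> halted x m (conf pc g).
Proof.
move=> le; rewrite /halted conf_pos; have := suffix_of_enc_drop pc xs.
by rewrite drop_oversize // => /bit_at_cons ->.
Qed.

Lemma step_conf pc g : pc < size prog ->
  step x m (conf pc g) =
  match nth (INC 0) prog pc with
  | INC q => conf pc.+1 (upd g q (g q).+1)
  | DECJZ q j => if g q == 0 then conf j g else conf pc.+1 (upd g q (g q).-1)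
  end.
Proof.
move=> ltpc; rewrite /step conf_pos; have := suffix_of_enc_drop pc xs.
have := all_nthP (INC 0) regsK pc ltpc.
rewrite enc_prog_drop // -catA; set t := _ ++ r; rewrite /step_at.
have sz b1 b2 (w : seq bool) : size [:: b1, b2 & w] - 2 = size w by rewrite /= subn2.
case: (nth _ _ _) => [q|q j] qK; rewrite ?enc_incE ?enc_decjzE => xs0;
  have xs1 := suffix_of_cat (s := [:: true]) xs0; rewrite (bit_at_cons xs0) (bit_at_cons xs1);
  have xs2 := suffix_of_cat (s := [:: _]) xs1; rewrite sz.
- rewrite ones_nseq //=; rewrite /conf regs_code_upd // (regs_codeD g qK) !expnS.
  by rewrite -!mulnA (mulnCA (fermat q) (2 ^ pc)).
- rewrite ones_nseq // skip_unary_nseq // fermat_dvd_regs_code //=.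
  case: eqP => [g0|/eqP g0]; last first.
    rewrite /conf regs_code_upd // (regs_codeD g qK) -{1}[g q]prednK ?lt0n // !expnS.
    by rewrite -!mulnA mulnCA mulKn.
  rewrite logn2_regs_code /conf mulKn ?expn_gt0 //= ones_nseq; first exact: mulnC.
  by have xs3 := suffix_of_cat xs2; have := suffix_of_cat (s := [:: false]) xs3.
Qed.

(** The fuel serves as the number of simulated steps; if the machine stops earlier, the simulation
    idles in the halted configuration. *)
Lemma exec_conf n pc g g' : exec n prog g pc = Some g' ->
  exists pc', let S := iter n (fun S => step x m S) (conf pc g) in
    halted x m S /\ S = conf pc' g'.
Proof.
elim: n pc g => // n IH pc g; rewrite [exec _ _ _ _]/= iterSr.
case: ltnP => [ltpc|le].
- rewrite step_conf //; case: (nth _ _ _) => [q|q j]; rewrite ?(upd_map S) ?(upd_map predn).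
    exact: IH.
  by case: ifP => _; apply: IH.
- case=> <-; exists pc; have h := conf_end g le.
  have -> : iter n (fun S => step x m S) (step x m (conf pc g)) = conf pc g.
    by rewrite -iterSr; elim: n.+1 => //= k ->; rewrite step_halted.
  by [].
Qed.

End Simulation.

(** The product in [regs_code] needs a finite range of registers, which has to include the input
    registers 0 and 1. *)
Lemma regs_bound (prog : seq instr) : exists2 K, 1 < K & all (fun i => reg_of i < K) prog.
Proof.
elim: prog => [|i p [K K1 pK]]; first by exists 2.
exists (maxn K (reg_of i).+1); first by rewrite leq_max K1.
rewrite /= leq_maxr; apply: sub_all pK => j /= ltj.
exact: leq_trans ltj (leq_maxl _ _).
Qed.

Lemma uni_outputs p v u : outputs p v u ->
  exists t, uni (nat_of_bits p) (nat_of_bits v) t = (nat_of_bits u).+1.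
Proof.
case=> n; rewrite /uni trunc_log_bits; case: p => [|[] q]; rewrite /run_U //; last first.
  case=> ->; exists 0; have xs := suffix_of_all (false :: u).
  rewrite [size _]/= (bit_at_cons xs) /= suffix_valE //.
  exact: (suffix_of_cat (s := [:: false]) xs).
have xs := suffix_of_all (true :: q); rewrite [size _]/= (bit_at_cons xs) [_ == 0]/=.
have {}xs := suffix_of_cat (s := [:: true]) xs.
case E: (parse_prog _ q) => [[prog r]|] // /esym; have Eq := parse_progE E.
case Ee: (exec _ _ _ _) => [g|] // [->]; rewrite {}Eq in xs *.
have [K K1 pK] := regs_bound prog.
have [pc'] := exec_conf xs pK Ee.
set x := (nat_of_bits _).+1 in xs *; set m := size (_ ++ _) => -[h ES].
have Es : start x (nat_of_bits v) m = 2 ^ 0 * regs_code K (init_regs r v).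
  have -> : start x (nat_of_bits v) m = 3 ^ nat_of_bits r * 5 ^ nat_of_bits v.
    rewrite /start posE // drop_oversize; last first.
      by rewrite /m size_cat (leq_trans (ltnW (size_enc_prog _))) ?leq_addr.
    congr (3 ^ _ * _); have {}xs : suffix_of x r := suffix_of_cat xs.
    exact: suffix_valE.
  case: K K1 {pK ES h} => [|[|K]] // _.
  rewrite mul1n /regs_code !big_ord_recl /= big1 ?muln1 //.
rewrite [size _]/= [_.-1]/= -/m.
by exists n; rewrite /config Es h ES logn3_regs_code ?bits_of_natK // ltnW.
Qed.

(** * Computability of the interpreter *)

Lemma comp_bit_at f g : computable f -> computable g -> computable (fun e => bit_at (f e) (g e)).
Proof. by rewrite /bit_at => cf cg; comp_tac. Qed.

Lemma comp_suffix_val f g :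
  computable f -> computable g -> computable (fun e => suffix_val (f e) (g e)).
Proof. by rewrite /suffix_val => cf cg; comp_tac. Qed.

Lemma comp_ones f g : computable f -> computable g -> computable (fun e => ones (f e) (g e)).
Proof. by rewrite /ones => cf cg; comp_tac; apply: comp_bit_at; comp_tac. Qed.

Lemma comp_skip_unary f g :
  computable f -> computable g -> computable (fun e => skip_unary (f e) (g e)).
Proof. by rewrite /skip_unary => cf cg; comp_tac; apply: comp_ones. Qed.

Ltac comp_bits_step :=
  match goal with
  | |- computable (fun e => bit_at _ _) => apply comp_bit_at
  | |- computable (fun e => suffix_val _ _) => apply comp_suffix_val
  | |- computable (fun e => ones _ _) => apply comp_ones
  | |- computable (fun e => skip_unary _ _) => apply comp_skip_unary
  | |- computable (fun e => trunc_log 2 _) => apply comp_trunc_log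
  | |- computable (fun e => logn _ _) => apply: comp_logn => //
  | |- computable (fun e => nat_of_bool (dvdn _ _)) => apply comp_dvdn
  end.
Ltac comp_bits_tac := repeat first [comp_leaf | comp_step | comp_bits_step].

Lemma comp_pos f g h : computable f -> computable g -> computable h ->
  computable (fun e => pos (f e) (g e) (h e)).
Proof. by rewrite /pos /next_pos => cf cg ch; comp_bits_tac. Qed.

Lemma comp_fermat f : computable f -> computable (fun e => fermat (f e)).
Proof. by rewrite /fermat => cf; comp_tac. Qed.

Lemma comp_step_at f g h : computable f -> computable g -> computable h ->
  computable (fun e => step_at (f e) (g e) (h e)).
Proof.
rewrite /step_at => cf cg ch.
by repeat first [comp_leaf | comp_step | comp_bits_step | apply comp_fermat].
Qed.

Lemma comp_halted f g h : computable f -> computable g -> computable h ->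
  computable (fun e => halted (f e) (g e) (h e)).
Proof. by rewrite /halted => cf cg ch; comp_bits_tac; apply: comp_pos; comp_bits_tac. Qed.

Lemma comp_config f g h k : computable f -> computable g -> computable h -> computable k ->
  computable (fun e => config (f e) (g e) (h e) (k e)).
Proof.
rewrite /config /start /step => cf cg ch ck; comp_bits_tac; first by apply: comp_pos.
by apply: comp_step_at; comp_bits_tac; apply: comp_pos; comp_bits_tac.
Qed.

Lemma comp_uni f g h : computable f -> computable g -> computable h ->
  computable (fun e => uni (f e) (g e) (h e)).
Proof.
rewrite /uni => cf cg ch.
by repeat first [comp_leaf | comp_step | comp_bits_step | apply comp_halted | apply comp_config].
Qed.

(** * Tables and greedy matching *)

Definition digit B x i := x %/ B ^ i %% B.
Definition pack B (F : nat -> nat) n := \sum_(i < n) F i * B ^ i.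

Lemma packS B F n : pack B F n.+1 = pack B F n + F n * B ^ n.
Proof. by rewrite /pack big_ord_recr. Qed.

Lemma pack_lt B F n : (forall i, i < n -> F i < B) -> pack B F n < B ^ n.
Proof.
elim: n => [|n IH] FB; first by rewrite /pack big_ord0.
rewrite packS expnS; have := IH (fun i lt => FB i (ltnW lt)).
by have := FB n (ltnSn n); nia.
Qed.

Lemma digit_pack B F n i : (forall i, i < n -> F i < B) -> i < n ->
  digit B (pack B F n) i = F i.
Proof.
elim: n => // n IH FB; rewrite ltnS leq_eqVlt packS => /predU1P[->|lt].
  have FB' : pack B F n < B ^ n by apply: pack_lt => j lt; apply/FB/ltnW.
  have B0 : 0 < B ^ n by apply: leq_ltn_trans FB'.
  by rewrite /digit addnC divnMDl // divn_small // addn0 modn_small ?FB.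
have B0 : 0 < B ^ i by rewrite expn_gt0 (leq_ltn_trans _ (FB i (ltnW lt))).
have -> : F n * B ^ n = F n * B ^ (n - i.+1) * B * B ^ i.
  by rewrite -!mulnA -expnS -expnD subnK.
rewrite /digit addnC divnMDl // modnMDl -/(digit _ _ _) IH // => j ltj.
exact/FB/ltnW.
Qed.

(** This exceeds the numbers of all strings shorter than [2 ^ l]; programs thus have to be told [l]
    only, and not [N]. *)
Definition bound l := 2 ^ 2 ^ l.

(* The table [t] codes the function mapping [x < bound l] to its [x]-th digit in base
   [bound l]; [table l t] also records [l]. *)
Definition table l t := 2 ^ l * (2 * t).+1.
Definition lookup R x := digit (bound (logn 2 R)) (R %/ 2 ^ logn 2 R %/ 2) x.

Lemma untable l t : logn 2 (table l t) = l /\ table l t %/ 2 ^ l %/ 2 = t.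
Proof.
split; last by rewrite /table mulKn ?expn_gt0 // mul2n divn2 /= uphalf_double.
rewrite lognM ?expn_gt0 // pfactorK // logn_coprime ?addn0 //.
by rewrite coprime2n /= mul2n odd_double.
Qed.

Lemma lookup_table l t x : lookup (table l t) x = digit (bound l) t x.
Proof. by rewrite /lookup; have [-> ->] := untable l t. Qed.

(** The condition is a whole program, a prefix numbered [c] followed by the bits of the table; this
    is its number. *)
Definition table_number c l t := c * 2 ^ trunc_log 2 (table l t).+1 + table l t.

Lemma table_numberE s l t :
  nat_of_bits (s ++ bits_of_nat (table l t)) = table_number (nat_of_bits s) l t.
Proof.
apply: succn_inj; rewrite nat_of_bits_cat bits_of_natK size_bits_of_nat.
by rewrite addnS.
Qed.

Section Matching.
Variables c l k : nat.
Let M := bound l.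

(** In base [bound l] the two low digits of an index are a pair and the rest is a time, so counting
    upwards dovetails all pairs with all times. *)
Definition time n := n %/ bound l %/ bound l.
Definition left n := n %/ bound l %% bound l.
Definition right n := n %% bound l.

(* No table mapping [left n] to [right n] hides [right n]: by time [time n], each of them
   is seen to have a short program for [right n]. *)
Definition bad n :=
  all (fun t => ~~ ((digit (bound l) t (left n) == right n) &&
    ~~ has (fun p => uni p (table_number c l t) (time n) == (right n).+1) (iota 0 (2 ^ k))))
  (iota 0 (bound l ^ bound l)).

(* The greedy matching: [hist n] has binary digit [1] at the selected indices below [n]. *)
Definition new n h := bad n &&
  all (fun i => ~~ ((digit 2 h i == 1) && ~~ ((left i != left n) && (right i != right n))))
    (iota 0 n).
Definition hist n := nat_rect (fun=> nat) 0 (fun i h => h + new i h * 2 ^ i) n.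
Definition sel n := new n (hist n).
Definition rank n := nat_rect (fun=> nat) 0 (fun i y => y + sel i) n.

Lemma M_gt0 : 0 < M. Proof. by rewrite expn_gt0. Qed.

Lemma hist_digit n i : i < n -> digit 2 (hist n) i = sel i.
Proof.
have -> : hist n = pack 2 (fun i => sel i) n.
  by elim: n => [|n IH]; rewrite ?packS -?IH /pack ?big_ord0.
by move=> lt; rewrite digit_pack // => j _; case: (sel j).
Qed.

Lemma selE n : sel n = bad n &&
  all (fun i => sel i ==> (left i != left n) && (right i != right n)) (iota 0 n).
Proof.
rewrite {1}/sel /new; congr (_ && _); apply: eq_in_all => i; rewrite mem_iota => /andP[_ lt].
by rewrite hist_digit //; case: (sel i) ; rewrite /= ?negbK.
Qed.

Definition selected n := filter sel (iota 0 n).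

Lemma selectedS n : selected n.+1 = selected n ++ nseq (sel n) n.
Proof.
by rewrite /selected -[n.+1]addn1 iotaD filter_cat /= add0n; case: (sel n).
Qed.

Lemma size_selected n : size (selected n) = rank n.
Proof. by elim: n => //= n IH; rewrite selectedS size_cat size_nseq IH. Qed.

Lemma uniq_selected n : uniq (map left (selected n)) && uniq (map right (selected n)).
Proof.
elim: n => // n IH; rewrite selectedS; case E: (sel n); rewrite ?cats0 //=.
rewrite !map_cat !cats1 !rcons_uniq; case/andP: IH => -> ->; rewrite !andbT.
move: E; rewrite selE => /andP[_ /allP H].
apply/andP; split; apply/mapP => -[i]; rewrite mem_filter => /andP[si /H];
  rewrite si => /andP[]; do ?[by move=> /eqP ne _ /esym]; by move=> _ /eqP ne /esym.
Qed.

Lemma time_le n : time n <= n.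
Proof. by rewrite /time !(leq_trans (leq_div _ _)). Qed.

(** For the table through all selected edges, badness makes each of their distinct right ends the
    output of a program numbered below [2 ^ k]. *)
Lemma rank_le n : rank n <= 2 ^ k.
Proof.
rewrite -size_selected; set s := selected n.
have /andP[ul ur] := uniq_selected n.
(* Away from the left ends [nth] returns its default 0, so [F] is a total function with values below
   [M]. *)
pose F x := right (nth 0 s (index x (map left s))).
pose t := pack M F M.
have FM x : F x < M by rewrite ltn_mod M_gt0.
have leftM i : left i < M by rewrite ltn_mod M_gt0.
have Ft i : i \in s -> digit M t (left i) = right i.
  move=> si; rewrite digit_pack // /F; congr right.
  have lti : index (left i) (map left s) = index i s.
    rewrite -{1}(nth_index 0 si) -(nth_map _ 0) ?index_mem // index_uniq //.
    by rewrite size_map index_mem.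
  by rewrite lti nth_index.
rewrite -(size_map right) -[2 ^ k](size_iota 0).
rewrite -(size_map (fun p => (uni p (table_number c l t) n).-1) (iota _ _)).
apply: uniq_leq_size => // _ /mapP[i si ->].
have := si; rewrite mem_filter selE mem_iota => /andP[/andP[/allP bi _] /andP[_ lti]].
have tM : t \in iota 0 (M ^ M) by rewrite mem_iota pack_lt.
have := bi t tM; rewrite Ft // eqxx /= negbK => /hasP[p pk /eqP up].
apply/mapP; exists p => //.
(* The times of the selected edges may differ; [n] bounds them all. *)
have le : time i <= n by apply: leq_trans (time_le i) (ltnW lti).
by rewrite (uni_mono le up).
Qed.

Lemma leq_rank m n : m <= n -> rank m <= rank n.
Proof. by move=> /subnK <-; elim: (n - m) => //= d IH; exact: leq_trans IH (leq_addr _ _). Qed.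

(** If [n] is not selected itself, an earlier edge shares an end with it. As the rank grows right
    after each selected index, it identifies the edge. *)
Lemma bad_selected n : bad n -> exists i,
  [/\ sel i, rank i < 2 ^ k, forall m, m < i -> ~~ (sel m && (rank m == rank i)) &
      (left i == left n) || (right i == right n)].
Proof.
move=> bn; suff [i si lr] : exists2 i, sel i & (left i == left n) || (right i == right n).
  exists i; split=> //.
    by have := rank_le i.+1; rewrite /= si addn1.
  move=> m lt; apply/negP => /andP[sm /eqP E].
  by have := leq_rank lt; rewrite /= sm addn1 E ltnn.
have [sn|] := boolP (sel n); first by exists n; rewrite // eqxx.
rewrite selE bn /= => /allPn[i _]; rewrite negb_imply => /andP[si].
by rewrite negb_and !negbK; exists i.
Qed.

End Matching.

(** * Computability of the matching *)

Ltac comp_uni_tac := repeat first [comp_leaf | comp_step | comp_bits_step | apply comp_uni].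

Lemma comp_digit f g h : computable f -> computable g -> computable h ->
  computable (fun e => digit (f e) (g e) (h e)).
Proof. by rewrite /digit => *; comp_uni_tac. Qed.

Lemma comp_bound f : computable f -> computable (fun e => bound (f e)).
Proof. by rewrite /bound => *; comp_uni_tac. Qed.

Lemma comp_lookup f g : computable f -> computable g ->
  computable (fun e => lookup (f e) (g e)).
Proof.
by rewrite /lookup => *; apply: comp_digit; [apply: comp_bound | |]; comp_uni_tac.
Qed.

Lemma comp_table_number c f g : computable f -> computable g ->
  computable (fun e => table_number c (f e) (g e)).
Proof. by rewrite /table_number /table => *; comp_uni_tac. Qed.

Lemma comp_bad c fl fk f : computable fl -> computable fk -> computable f ->
  computable (fun e => bad c (fl e) (fk e) (f e)).
Proof.
rewrite /bad /time /left /right => cl ck cf.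
by repeat first [comp_leaf | comp_step | comp_bits_step | apply comp_uni | apply comp_digit
  | apply comp_bound | apply comp_table_number].
Qed.

Lemma comp_new c fl fk f h : computable fl -> computable fk -> computable f ->
  computable h -> computable (fun e => new c (fl e) (fk e) (f e) (h e)).
Proof.
rewrite /new /left /right => cl ck cf ch.
by repeat first [comp_leaf | comp_step | apply comp_bad | apply comp_digit | apply comp_bound].
Qed.

Lemma comp_sel c fl fk f : computable fl -> computable fk -> computable f ->
  computable (fun e => sel c (fl e) (fk e) (f e)).
Proof.
rewrite /sel => cl ck cf; apply: comp_new => //.
apply: (comp_rec (st := fun y i e => y + new c (fl e) (fk e) i y * 2 ^ i)) => //.
  exact: comp0.
by repeat first [comp_leaf | comp_step | apply comp_new].
Qed.

Lemma comp_rank c fl fk f : computable fl -> computable fk -> computable f ->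
  computable (fun e => rank c (fl e) (fk e) (f e)).
Proof.
move=> cl ck cf.
apply: (comp_rec (st := fun y i e => y + sel c (fl e) (fk e) i)) => //.
  exact: comp0.
by repeat first [comp_leaf | comp_step | apply comp_sel].
Qed.

(** * Short descriptions of strings, and the theorem *)

Lemma least_witness (P : pred nat) m : P m ->
  exists2 n, P n & forall i, i < n -> ~~ P i.
Proof.
move=> Pm; case: (ex_minnP (ex_intro _ m Pm)) => n Pn le; exists n => // i lt.
by apply/negP => /le; rewrite leqNgt lt.
Qed.

(** An interpreter put before a program for [b] runs it on the empty input, whatever the condition;
    the search is over the running time. *)
Lemma KScond_of_unconditional : exists c, forall b v, KScond b v <= KS b + c.
Proof.
pose P e := uni (nth 0 e 1) 0 (nth 0 e 0) != 0.
pose g e := (uni (nth 0 e 1) 0 (nth 0 e 0)).-1.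
have [||q Hq] := @search_program P g; rewrite ?/P ?/g; first by comp_uni_tac.
  by comp_uni_tac.
exists (size q).+1 => b v; rewrite /KS; have [p op <-] := KScond_prog b [::].
have [t ut] := uni_outputs op.
have [|m Pm lt] := @least_witness (fun m => P [:: m; nat_of_bits p; nat_of_bits v]) t.
  by rewrite /P /= ut.
have := Hq p v m Pm lt; rewrite /g /=; move: Pm; rewrite /P /=.
case um: (uni _ _ _) => [//|y] _; rewrite (uni_fun um ut) nat_of_bitsK => /KScond_le.
by rewrite /= size_cat addnS addnC.
Qed.

(** The interpreter obtains [a] from a program for it, and the condition supplies the table once the
    [size s] bits in front are cut off. *)
Lemma KScond_of_table s : exists c, forall a b l t,
  digit (bound l) t (nat_of_bits a) = nat_of_bits b ->
  KScond b (s ++ bits_of_nat (table l t)) <= KS a + c.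
Proof.
pose P e := uni (nth 0 e 1) 0 (nth 0 e 0) != 0.
pose g e := lookup
  (suffix_val (nth 0 e 2).+1 (trunc_log 2 (nth 0 e 2).+1 - size s))
  (uni (nth 0 e 1) 0 (nth 0 e 0)).-1.
have [||q Hq] := @search_program P g; rewrite ?/P ?/g; first by comp_uni_tac.
  by apply: comp_lookup; comp_uni_tac.
exists (size q).+1 => a b l t eab; rewrite /KS; have [p op <-] := KScond_prog a [::].
have [t' ut] := uni_outputs op; set v := s ++ _.
have [|m Pm lt] := @least_witness (fun m => P [:: m; nat_of_bits p; nat_of_bits v]) t'.
  by rewrite /P /= ut.
have := Hq p v m Pm lt; rewrite /g /=; move: Pm; rewrite /P /=.
case um: (uni _ _ _) => [//|y] _; rewrite (uni_fun um ut).
rewrite trunc_log_bits {2}/v size_cat addKn suffix_valE; last first.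
  exact: suffix_of_cat (suffix_of_all v).
rewrite bits_of_natK lookup_table eab nat_of_bitsK => /KScond_le.
by rewrite /= size_cat addnS addnC.
Qed.

Lemma table_program : exists q, forall l t a b,
  digit (bound l) t (nat_of_bits a) = nat_of_bits b ->
  outputs (true :: q ++ bits_of_nat (table l t)) a b.
Proof.
pose P e := nth 0 e 0 == 0.
pose g e := lookup (nth 0 e 1) (nth 0 e 2).
have [||q Hq] := @search_program P g; rewrite ?/P ?/g; first by comp_uni_tac.
  by apply: comp_lookup; comp_uni_tac.
exists q => l t a b eab; have := Hq (bits_of_nat (table l t)) a 0 (eqxx _).
by rewrite /g /= bits_of_natK lookup_table eab nat_of_bitsK; apply.
Qed.

(* The number [2 ^ l * (2 * y + 1)] with [y = j * 2 ^ l.+1 + k] carries the parameters. *)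
Lemma KS_selected c (h : nat -> nat -> nat) :
  (forall f g, computable f -> computable g -> computable (fun e => h (f e) (g e))) ->
  exists d, forall l k i, k < 2 ^ l.+1 -> sel c l k i -> rank c l k i < 2 ^ k ->
    (forall m, m < i -> ~~ (sel c l k m && (rank c l k m == rank c l k i))) ->
    KS (bits_of_nat (h l i)) <= k + 2 * l + d.
Proof.
move=> ch; pose L (e : seq nat) := logn 2 (nth 0 e 1).
pose Y (e : seq nat) := nth 0 e 1 %/ 2 ^ L e %/ 2.
pose P e := sel c (L e) (Y e %% 2 ^ (L e).+1) (nth 0 e 0) &&
  (rank c (L e) (Y e %% 2 ^ (L e).+1) (nth 0 e 0) == Y e %/ 2 ^ (L e).+1).
have cL : computable L by rewrite /L; comp_uni_tac.
have cY : computable Y by rewrite /Y; comp_uni_tac.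
have [||q Hq] := @search_program P (fun e => h (L e) (nth 0 e 0)).
- by rewrite /P; repeat first [comp_leaf | comp_step | apply comp_sel | apply comp_rank].
- by apply: ch; comp_uni_tac.
exists (size q + 3) => l k i kl si ri lt.
set j := rank c l k i in ri lt; set y := j * 2 ^ l.+1 + k.
have [EL EY] := untable l y; set X := table l y in EL EY.
have Ek : y %% 2 ^ l.+1 = k by rewrite /y modnMDl modn_small.
have Ej : y %/ 2 ^ l.+1 = j by rewrite /y divnMDl ?expn_gt0 // divn_small ?addn0.
have Penv m : P [:: m; X; 0] = sel c l k m && (rank c l k m == j).
  by rewrite /P /Y /L /= EL EY Ek Ej.
have /KScond_le le : outputs (true :: q ++ bits_of_nat X) [::] (bits_of_nat (h l i)).
  have := Hq (bits_of_nat X) [::] i; rewrite /= bits_of_natK /L /= EL.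
  apply=> [|m ltm]; first by apply: etrans (Penv i) _; rewrite si eqxx.
  by have := lt m ltm; rewrite -Penv.
apply: leq_trans le _; rewrite /= size_cat size_bits_of_nat.
(* As [k < 2 ^ l.+1] and the rank is below [2 ^ k], the number [y] is below [2 ^ (k + l + 1)];
   [table] contributes [l + 1] more bits. *)
have leX : X.+1 <= 2 ^ (k + 2 * l + 2).
  have : y < 2 ^ k * 2 ^ l.+1 by rewrite /y; nia.
  rewrite /X /table mul2n -addnn !expnD !expnS expn0.
  by have := expn_gt0 2 l; have := expn_gt0 2 k; nia.
have : trunc_log 2 X.+1 <= k + 2 * l + 2.
  by rewrite -[_ + 2](@trunc_expnK 2) // leq_trunc_log.
lia.
Qed.

(** Each of the finitely many tables comes with a time of its own, whereas badness asks for one time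
    common to all. *)
Lemma common_bound (Q : nat -> nat -> Prop) n :
  (forall t T T', T <= T' -> Q t T -> Q t T') ->
  (forall t, t < n -> exists T, Q t T) -> exists T, forall t, t < n -> Q t T.
Proof.
move=> mono; elim: n => [|n IH] H; first by exists 0.
have [T HT] := IH (fun t lt => H t (ltnW lt)); have [T' HT'] := H n (ltnSn n).
exists (maxn T T') => t; rewrite ltnS leq_eqVlt => /predU1P[->|lt].
  exact: mono (leq_maxr _ _) HT'.
exact: mono (leq_maxl _ _) (HT t lt).
Qed.

Theorem theorem1 :
  exists C : nat, forall (N : nat) (a b : seq bool),
    size a <= N -> size b <= N ->
    exists f : seq bool,
      outputs f a b /\
      KScond b f <= minn (KS a) (KS b) + C * logN N /\
      minn (KS a) (KS b) <= KScond b f + C * logN N.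
Proof.
have [q Hq] := table_program.
have [c0 H0] := KScond_of_unconditional.
have [c1 H1] := KScond_of_table (true :: q).
(* With this prefix, [table_number c l t] is the number of the program [f t] itself. *)
pose c := nat_of_bits (true :: q).
have [|d2 H2] := @KS_selected c left.
  by move=> *; rewrite /left; repeat first [comp_leaf | comp_step | apply comp_bound].
have [|d3 H3] := @KS_selected c right.
  by move=> *; rewrite /right; repeat first [comp_leaf | comp_step | apply comp_bound].
(* Since [l > 0], [D * l] exceeds the overheads [2 * l + d2] and [2 * l + d3] of describing an end
   of an edge; [c0] and [c1] are for the upper bound. *)
pose D := d2 + d3 + 3; exists (c0 + c1 + D) => N a b aN bN.
set l := logN N; set K := minn (KS a) (KS b).
have l0 : 0 < l by [].
have Nl : N < 2 ^ l by apply: trunc_log_ltn.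
have ltM s : size s <= N -> nat_of_bits s < bound l.
  move=> sN; have /andP[_ lt] := nat_of_bits_bounds s.
  have : 2 ^ (size s).+1 <= bound l by rewrite leq_exp2l // (leq_ltn_trans sN).
  by apply: leq_trans; apply: ltnW.
have aM := ltM a aN; have bM := ltM b bN.
pose f t := true :: q ++ bits_of_nat (table l t).
suff [t eab Kf] : exists2 t, digit (bound l) t (nat_of_bits a) = nat_of_bits b &
    K <= KScond b (f t) + D * l.
  exists (f t); split; first exact: Hq; split; last first.
    by apply: leq_trans Kf _; rewrite leq_add2l leq_mul2r leq_addl orbT.
  have := leq_trans (leq_addr D (c0 + c1)) (leq_pmulr _ l0).
  have : KScond b (f t) <= KS a + c1 := H1 a b l t eab.
  have := H0 b (f t); rewrite /K.
  by move: (_ * l) => w; lia.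
(* The constant table maps [a] to [b], which is enough when the minimum is at most [D * l]. *)
pose t0 := pack (bound l) (fun=> nat_of_bits b) (bound l).
have t0E : digit (bound l) t0 (nat_of_bits a) = nat_of_bits b by rewrite digit_pack.
have [small|large] := leqP K (D * l).
  by exists t0; rewrite // (leq_trans small) ?leq_addl.
pose k := K - D * l.
(* Either some table mapping [a] to [b] leaves [b] with complexity at least [k], or the pair will
   turn out to be bad. *)
have [/allP all_easy|] := boolP (all (fun t =>
  (digit (bound l) t (nat_of_bits a) == nat_of_bits b) ==> (KScond b (f t) < k))
  (iota 0 (bound l ^ bound l))); last first.
  move=> /allPn[t _]; rewrite negb_imply -leqNgt => /andP[/eqP eab le].
  by exists t; rewrite // addnC -leq_subLR.
have [T HT] : exists T, forall t, t < bound l ^ bound l ->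
    digit (bound l) t (nat_of_bits a) = nat_of_bits b ->
    has (fun p => uni p (table_number c l t) T == (nat_of_bits b).+1) (iota 0 (2 ^ k)).
  apply: common_bound => [t T T' le H /H /hasP[p pk /eqP up]|t tM].
    by apply/hasP; exists p; rewrite // (uni_mono le up).
  have [/eqP eab|ne] := boolP (digit (bound l) t (nat_of_bits a) == nat_of_bits b); last first.
    by exists 0 => eab; rewrite eab eqxx in ne.
  have := all_easy t; rewrite mem_iota eab eqxx => /(_ tM) /= lt.
  have [p op sp] := KScond_prog b (f t); have [T uT] := uni_outputs op.
  exists T => _; apply/hasP; exists (nat_of_bits p).
    (* A program of length below [k] has a number below [2 ^ k]. *)
    rewrite mem_iota /=; have /andP[_ ltp] := nat_of_bits_bounds p.
    rewrite -ltnS (leq_trans ltp) // ltnW // ltnS leq_exp2l // sp //.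
  by rewrite -table_numberE; apply/eqP.
pose n := (T * bound l + nat_of_bits a) * bound l + nat_of_bits b.
have M0 : 0 < bound l by apply: leq_ltn_trans aM.
have rn : right l n = nat_of_bits b by rewrite /right modnMDl modn_small.
have dn : n %/ bound l = T * bound l + nat_of_bits a.
  by rewrite divnMDl // divn_small ?addn0.
have ln : left l n = nat_of_bits a by rewrite /left dn modnMDl modn_small.
have tn : time l n = T by rewrite /time dn divnMDl // divn_small ?addn0.
have bn : bad c l k n.
  apply/allP => t; rewrite mem_iota rn ln tn negb_and negbK => tM.
  by case: eqP => //= eab; apply: HT.
have [i [si ri lti lr]] := bad_selected bn.
(* [k] must fit into [l + 1] bits; the literal program for [b] bounds it by [N + 1]. *)
have kl : k < 2 ^ l.+1.
  have : KS b <= (size b).+1 by apply: (@KScond_le (false :: b)); exists 0.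
  by rewrite expnS /k /K; lia.
have := H2 l k i kl si ri lti; have := H3 l k i kl si ri lti.
have ck : k + D * l = K by rewrite subnK // ltnW.
have dl : d2 + d3 + 3 * l <= D * l by rewrite /D; nia.
(* One of [a] and [b] is an end of the edge [i], so its complexity falls below [K], a
   contradiction. *)
case/orP: lr => /eqP ->; rewrite ?ln ?rn nat_of_bitsK /K in ck *; lia.
Qed.
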